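(* Let $\mu$ be a probability measure on $2^{\mathbb{N}}$ which is a countable sum of measures $\mu=\sum_{n}\mu_{n}$, where $(\mu_{n})_{n\in\mathbb{N}}$ is a sequence of finite Borel measures on $2^{\mathbb{N}}$ with $\mu_{n}$ computable uniformly in $n$. If $x$ is $\mu$-computably random, then $x$ is $\mu_{n}$-computably random for some $n$.
   Context: $2^{\mathbb{N}}$ is Cantor space, $[\sigma]$ the cylinder of sequences extending a finite string $\sigma\in2^*$, $\mu(\sigma)=\mu([\sigma])$. A finite Borel measure on $2^{\mathbb{N}}$ is computable if $\sigma\mapsto\mu(\sigma)$ is computable (uniformly in $n$ for a sequence: $(n,\sigma)\mapsto\mu_n(\sigma)$ computable). A function $t\colon2^{\mathbb{N}}\to[0,\infty]$ is lower semicomputable if it is the sum of a computable sequence of computable functions $2^{\mathbb{N}}\to[0,\infty)$. For a finite Borel measure $\mu$, $x$ is $\mu$-computably random if $t(x)<\infty$ for every lower semicomputable $t$ and every computable probability measure $\nu$ with $\int_{[\sigma]}t\,d\mu\le\nu(\sigma)$ for all $\sigma\in2^{*}$. *)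

(* Defs.v *)
From HB Require Import structures.
From mathcomp Require Import all_boot all_order all_algebra.
From mathcomp Require Import all_classical all_reals all_analysis.

Set Implicit Arguments.
Unset Strict Implicit.
Unset Printing Implicit Defensive.

Import Order.TTheory GRing.Theory Num.Theory.
Import numFieldNormedType.Exports.

Local Open Scope classical_set_scope.
Local Open Scope ring_scope.

(* Cantor space with its Borel sigma-algebra. *)
Notation cantor := (g_sigma_algebraType (@open cantor_space)).

Definition cylinder (s : seq bool) : set cantor :=
  [set x : cantor | forall i, (i < size s)%N -> x i = nth false s i].

(* Total functionals 2^N x N^k -> N that are computable with the first argument
   as an oracle: the recursive functions relative to x, uniformly in x, with
   minimization restricted to the regular case (a zero exists for every oracle
   and all arguments). By Kleene's normal form theorem, relativized, these are
   exactly the everywhere defined partial recursive functionals. Computable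
   functions N^k -> N are those whose value does not depend on the oracle. *)
Inductive recursive : forall k : nat, (cantor -> k.-tuple nat -> nat) -> Prop :=
| rec_zero k : @recursive k (fun _ _ => 0%N)
| rec_succ : @recursive 1 (fun _ v => (thead v).+1)
| rec_proj k (i : 'I_k) : @recursive k (fun _ v => tnth v i)
| rec_oracle : @recursive 1 (fun x v => nat_of_bool (x (thead v)))
| rec_comp k m (F : cantor -> m.-tuple nat -> nat)
    (G : 'I_m -> cantor -> k.-tuple nat -> nat) :
    recursive F -> (forall i, recursive (G i)) ->
    @recursive k (fun x v => F x [tuple G i x v | i < m])
| rec_prec k (F : cantor -> k.-tuple nat -> nat)
    (G : cantor -> k.+2.-tuple nat -> nat)
    (H : cantor -> k.+1.-tuple nat -> nat) :
    recursive F -> recursive G ->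
    (forall x (v : k.-tuple nat), H x [tuple of 0%N :: v] = F x v) ->
    (forall x n (v : k.-tuple nat), H x [tuple of n.+1 :: v] =
       G x [tuple of n :: H x [tuple of n :: v] :: v]) ->
    recursive H
| rec_min k (F : cantor -> k.+1.-tuple nat -> nat)
    (H : cantor -> k.-tuple nat -> nat) :
    recursive F ->
    (forall x (v : k.-tuple nat), F x [tuple of H x v :: v] = 0%N) ->
    (forall x (v : k.-tuple nat) n, (n < H x v)%N -> F x [tuple of n :: v] <> 0%N) ->
    recursive H.

(* The position of s in the length-lexicographic enumeration of 2^*; a bijection
   onto N. *)
Definition string_code (s : seq bool) : nat :=
  foldl (fun n (b : bool) => (n.*2 + b).+1) 0%N s.

(* A real-valued function of an oracle and an index is computable if a rational
   within 2^-n of its value can be computed from the oracle, n and the code of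
   the index. If f ignores its first argument, fixing any computable oracle in
   the approximation shows that this is computability of f as a function of the
   index only. *)
Definition computable_real (R : realType) (I : Type) (k : nat)
    (code : I -> k.-tuple nat) (f : cantor -> I -> R) : Prop :=
  exists a b c : cantor -> k.+1.-tuple nat -> nat,
    [/\ recursive a, recursive b, recursive c &
      forall (x : cantor) (i : I) (n : nat),
        let v := [tuple of n :: code i] in
        `|f x i - ((a x v)%:R - (b x v)%:R) / (c x v).+1%:R| <= 2 ^- n].

(* These two are meant for finite measures only, where fine loses nothing. *)
Definition computable_measure (R : realType) (m : set cantor -> \bar R) : Prop :=
  computable_real (fun s : seq bool => [tuple string_code s])
    (fun _ s => fine (m (cylinder s))).

Definition computable_measures (R : realType)
    (m : nat -> set cantor -> \bar R) : Prop :=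
  computable_real (fun p : nat * seq bool => [tuple p.1; string_code p.2])
    (fun _ p => fine (m p.1 (cylinder p.2))).

Definition lower_semicomputable (R : realType) (t : cantor -> \bar R) : Prop :=
  exists f : nat -> cantor -> R,
    [/\ forall i x, 0 <= f i x,
        computable_real (fun i : nat => [tuple i]) (fun x i => f i x) &
        forall x, t x = (\sum_(0 <= i <oo) (f i x)%:E)%E].

Definition computably_random (R : realType)
    (mu : {finite_measure set cantor -> \bar R}) (x : cantor) : Prop :=
  forall (t : cantor -> \bar R) (nu : probability cantor R),
    lower_semicomputable t -> computable_measure nu ->
    (forall s : seq bool,
       (\int[mu]_(y in cylinder s) t y <= nu (cylinder s))%E) ->
    (t x < +oo)%E.

(* Main.v *)
(* For x mu-random and a computable measure nu, the ratio nu/mu is bounded along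
   the prefixes of x: otherwise one bets on nu against mu, moving half of the
   remaining stake to a protected account each time nu/mu has doubled, and the
   number of such moves is a test that x fails. If M_i is a computable modulus
   such that sum_(n >= M_i) mu_n has mass at most 8^-i, then applying this to
   sum_i 2^i sum_(n >= M_i) mu_n bounds the tails along x: for some N,
   mu <= 2 * sum_(n < N) mu_n on long prefixes of x. Now suppose that, for
   each n, some test t_n for mu_n with bounding measure nu_n is infinite at x.
   By lower semicontinuity t_n >= C near x, so C * mu_n <= nu_n = O(mu) on long
   prefixes of x, for every C; summing over n < N contradicts the choice of N.
   Only the first step needs a computable construction, and it is applied to
   one measure at a time, so no uniformity in n of (t_n, nu_n) is required. *)
From HB Require Import structures.
Require Import Defs.
From mathcomp Require Import all_boot all_order all_algebra.
From mathcomp Require Import all_classical all_reals all_analysis.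
From mathcomp Require Import measurable_realfun zify lra.

Set Implicit Arguments.
Unset Strict Implicit.
Unset Printing Implicit Defensive.

Import Order.TTheory GRing.Theory Num.Theory.
Import numFieldNormedType.Exports.

Local Open Scope classical_set_scope.
Local Open Scope ring_scope.

(** * Recursive functionals *)

Section recursive_terms.
Local Open Scope nat_scope.

Lemma recursive_ext k (F G : cantor -> k.-tuple nat -> nat) :
  (forall x v, F x v = G x v) -> recursive F -> recursive G.
Proof.
move=> FG; suff -> : G = F by [].
by apply/funext => x; apply/funext => v; rewrite FG.
Qed.

(** Every oracle query becomes a query to the zero sequence, which is recursive. This turns the
    oracle-dependent approximations of [computable_real] into ordinary recursive functions. *)
Lemma recursive_fix_oracle k (F : cantor -> k.-tuple nat -> nat) :
  recursive F -> recursive (fun _ v => F (fun=> false) v).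
Proof.
elim=> {k F}.
- exact: rec_zero.
- exact: rec_succ.
- exact: rec_proj.
- exact: rec_zero.
- by move=> k m F G _ rF _ rG; exact: (rec_comp rF rG).
- move=> k F G H _ rF _ rG H0 HS; apply: (rec_prec rF rG) => [_ v|_ n v].
    exact: H0.
  exact: HS.
- move=> k F H _ rF H0 Hmin; apply: (rec_min rF) => [_ v|_ v n].
    exact: H0.
  exact: Hmin.
Qed.

(* A term is a function of the oracle and of an environment listing the values
   of its free variables; only the first K variables may be relevant. *)
Definition rterm (K : nat) (f : cantor -> (nat -> nat) -> nat) : Prop :=
  recursive (fun x (v : K.-tuple nat) => f x (nth 0 v)).

(** Stated as closure of terms under [f], so that recursiveness of a term is proved by following its
    syntax. *)
Definition rec1 (f : nat -> nat) := forall K g, rterm K g ->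
  rterm K (fun x e => f (g x e)).
Definition rec2 (f : nat -> nat -> nat) := forall K g h,
  rterm K g -> rterm K h -> rterm K (fun x e => f (g x e) (h x e)).
Definition rec3 (f : nat -> nat -> nat -> nat) := forall K g h l,
  rterm K g -> rterm K h -> rterm K l ->
  rterm K (fun x e => f (g x e) (h x e) (l x e)).

Lemma rterm_var K i : rterm K (fun _ e => e i).
Proof.
have [iK|Ki] := ltnP i K.
  apply: recursive_ext (rec_proj (Ordinal iK)) => x v.
  by rewrite (tnth_nth 0).
apply: recursive_ext (rec_zero K) => x v.
by rewrite nth_default// size_tuple.
Qed.

Lemma rterm_subst K m f (g : nat -> cantor -> (nat -> nat) -> nat) :
  rterm m f -> (forall i, rterm K (g i)) ->
  rterm K (fun x e => f x (fun i => if i < m then g i x e else 0)).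
Proof.
move=> rf rg; have := rec_comp rf (fun i : 'I_m => rg i).
apply: recursive_ext => x v; congr (f x _); apply/funext => i.
have [im|mi] := ltnP i m; last by rewrite nth_default// size_tuple.
by rewrite -(tnth_nth _ _ (Ordinal im)) tnth_mktuple.
Qed.

Lemma rec1_rterm f : rterm 1 (fun _ e => f (e 0)) -> rec1 f.
Proof. by move=> rf K g rg; apply: (rterm_subst (g := fun=> g) rf). Qed.

Lemma rec2_rterm f : rterm 2 (fun _ e => f (e 0) (e 1)) -> rec2 f.
Proof.
move=> rf K g h rg rh.
apply: (rterm_subst (g := fun i => if i is 0 then g else h) rf).
by case.
Qed.

Lemma rec3_rterm f : rterm 3 (fun _ e => f (e 0) (e 1) (e 2)) -> rec3 f.
Proof.
move=> rf K g h l rg rh rl.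
apply: (rterm_subst (g := fun i => match i with 0 => g | 1 => h | _ => l end) rf).
by do 2 case=> //.
Qed.

Lemma nth_tuple_trunc K (v : K.-tuple nat) :
  (fun i => if i < K then nth 0 v i else 0) = nth 0 v.
Proof.
apply/funext => i; case: ltnP => // Ki.
by rewrite nth_default// size_tuple.
Qed.

(** In the step, variable 0 is the counter and variable 1 the accumulator; the outer variables are
    shifted by two. The bound is first a separate variable, as primitive recursion requires, and [n]
    is then substituted for it. *)
Lemma rterm_iter K n z (s : cantor -> nat -> nat -> (nat -> nat) -> nat) :
  rterm K n -> rterm K z ->
  rterm K.+2 (fun x e => s x (e 0) (e 1) (fun i => e i.+2)) ->
  rterm K (fun x e => nat_rec _ (z x e) (fun m a => s x m a e) (n x e)).
Proof.
move=> rn rz rs.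
pose H x (e : nat -> nat) := let e' := fun i => e i.+1 in
  nat_rec _ (z x e') (fun m a => s x m a e') (e 0).
have rH : rterm K.+1 H by apply: (rec_prec rz rs).
have rg i : rterm K (if i is i'.+1 then fun _ e => e i' else n).
  by case: i => // i; exact: rterm_var.
apply: recursive_ext (rterm_subst rH rg) => x v.
by rewrite /H/= nth_tuple_trunc.
Qed.

Lemma rec1S : rec1 succn.
Proof.
apply: rec1_rterm; apply: recursive_ext rec_succ => _ v.
by rewrite /thead (tnth_nth 0).
Qed.

Lemma rterm_const K n : rterm K (fun _ _ => n).
Proof. by elim: n => [|n IH]; [exact: rec_zero | exact: rec1S]. Qed.

Lemma rterm_oracle K g : rterm K g -> rterm K (fun x e => x (g x e) : nat).
Proof.
move=> rg; have rO : rterm 1 (fun x e => x (e 0) : nat).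
  by apply: recursive_ext rec_oracle => x v; rewrite /thead (tnth_nth 0).
exact: (rterm_subst (g := fun=> g) rO).
Qed.

Lemma rec2D : rec2 addn.
Proof.
apply: rec2_rterm.
have := @rterm_iter 2 (fun _ e => e 1) (fun _ e => e 0) (fun _ _ a _ => a.+1).
move=> /(_ (rterm_var 2 1) (rterm_var 2 0) (rec1S (rterm_var 4 1))).
apply: recursive_ext => _ v; elim: (nth 0 v 1) => [|m /= ->].
  by rewrite addn0.
by rewrite addnS.
Qed.

Lemma rec1P : rec1 predn.
Proof.
apply: rec1_rterm.
have := @rterm_iter 1 (fun _ e => e 0) (fun _ e => 0) (fun _ m _ _ => m).
move=> /(_ (rterm_var 1 0) (rterm_const 1 0) (rterm_var 3 0)).
by apply: recursive_ext => _ v; case: (nth 0 v 0).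
Qed.

Lemma rec2B : rec2 subn.
Proof.
apply: rec2_rterm.
have := @rterm_iter 2 (fun _ e => e 1) (fun _ e => e 0) (fun _ _ a _ => a.-1).
move=> /(_ (rterm_var 2 1) (rterm_var 2 0) (rec1P (rterm_var 4 1))).
apply: recursive_ext => _ v; elim: (nth 0 v 1) => [|m /= ->].
  by rewrite subn0.
by rewrite subnS.
Qed.

Lemma rterm_sum K n (F : cantor -> nat -> (nat -> nat) -> nat) :
  rterm K n -> rterm K.+2 (fun x e => F x (e 0) (fun i => e i.+2)) ->
  rterm K (fun x e => \sum_(i < n x e) F x i e).
Proof.
move=> rn rF.
have := @rterm_iter K n (fun _ e => 0) (fun x m a e => a + F x m e).
move=> /(_ rn (rterm_const _ _) (rec2D (rterm_var _ 1) rF)).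
apply: recursive_ext => x v.
by elim: (n x _) => [|m /= ->]; rewrite ?big_ord0// big_ord_recr.
Qed.

Lemma rec2M : rec2 muln.
Proof.
apply: rec2_rterm.
have := @rterm_sum 2 (fun _ e => e 1) (fun _ _ e => e 0).
move=> /(_ (rterm_var 2 1) (rterm_var 4 2)).
by apply: recursive_ext => _ v; rewrite sum_nat_const card_ord mulnC.
Qed.

Lemma rec2X : rec2 expn.
Proof.
apply: rec2_rterm.
have := @rterm_iter 2 (fun _ e => e 1) (fun _ e => 1) (fun _ _ a e => a * e 0).
move=> /(_ (rterm_var _ _) (rterm_const _ _)).
move=> /(_ (rec2M (rterm_var 4 1) (rterm_var 4 2))).
apply: recursive_ext => _ v; elim: (nth 0 v 1) => [|m /= ->]//.
by rewrite expnSr.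
Qed.

Lemma rterm_leq K g h : rterm K g -> rterm K h ->
  rterm K (fun x e => g x e <= h x e : nat).
Proof.
move=> rg rh; apply: recursive_ext (rec2B (rterm_const K 1) (rec2B rg rh)).
by move=> x v; rewrite /leq; case: (g _ _ - h _ _).
Qed.

Lemma rterm_if K (b : cantor -> (nat -> nat) -> bool) g h :
  rterm K (fun x e => b x e) -> rterm K g -> rterm K h ->
  rterm K (fun x e => if b x e then g x e else h x e).
Proof.
move=> rb rg rh; have rnb := rec2B (rterm_const K 1) rb.
apply: recursive_ext (rec2D (rec2M rb rg) (rec2M rnb rh)) => x v /=.
by case: (b _ _); rewrite ?(subnn, subn0) !(mul0n, mul1n, addn0).
Qed.

(* The divisor is a successor because the sum below would give n rather than 0
   for n %/ 0. *)
Lemma rterm_div K g h : rterm K g -> rterm K h ->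
  rterm K (fun x e => g x e %/ (h x e).+1).
Proof.
move=> rg rh.
have rdiv : rec2 (fun m d => \sum_(i < m) (i.+1 * d.+1 <= m)).
  apply: rec2_rterm.
  apply: (@rterm_sum 2 (fun _ e => e 0)
            (fun _ i e => i.+1 * (e 1).+1 <= e 0 : nat)).
    exact: rterm_var.
  apply: rterm_leq (rterm_var _ 2).
  by apply: rec2M; apply: rec1S; exact: rterm_var.
apply: recursive_ext (rdiv _ _ _ rg rh) => x v.
move: (g _ _) (h _ _) => m d.
have -> : \sum_(i < m) (i.+1 * d.+1 <= m) = \sum_(i < m) (i < m %/ d.+1).
  by apply: eq_bigr => i _; rewrite leq_divRL.
have sum_lt (k n : nat) : \sum_(i < n) (i < k) = minn n k.
  elim: n => [|n IH]; first by rewrite big_ord0 min0n.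
  by rewrite big_ord_recr/= IH; lia.
by rewrite sum_lt; apply/minn_idPr; exact: leq_div.
Qed.

Lemma rec1_odd : rec1 (fun n => odd n : nat).
Proof.
apply: rec1_rterm.
have := @rterm_iter 1 (fun _ e => e 0) (fun _ e => 0) (fun _ _ a _ => 1 - a).
move=> /(_ (rterm_var 1 0) (rterm_const 1 0)).
move=> /(_ (rec2B (rterm_const _ 1) (rterm_var _ 1))).
apply: recursive_ext => _ v; elim: (nth 0 v 0) => [|m /= ->]//.
by case: odd.
Qed.

Lemma rec1_ex_minn (P : nat -> nat -> bool) (f : nat -> nat) :
  rterm 2 (fun _ e => P (e 0) (e 1)) ->
  (forall n, P (f n) n) -> (forall n m, m < f n -> ~~ P m n) -> rec1 f.
Proof.
move=> rP Pf fmin; apply: rec1_rterm.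
(* Minimization searches for a zero, hence 1 - P. *)
have rF := rec2B (rterm_const 2 1) rP.
apply: (rec_min rF) => [_ v|_ v n] /=.
  by rewrite Pf.
by move=> /fmin/negbTE ->.
Qed.

End recursive_terms.

(** * Recursion along the prefixes of a string *)

Section string_recursion.
Local Open Scope nat_scope.

(** The fuel makes a recursion on n.-1./2 structural; any fuel that is at least n gives the same
    value. *)
Fixpoint parent_rec_fuel T (z : T) (g : nat -> T -> T) (fuel n : nat) : T :=
  if fuel is fuel'.+1 then
    if n == 0 then z else g n (parent_rec_fuel z g fuel' n.-1./2)
  else z.

(* In the length-lexicographic coding the string with code n > 0 extends by one
   bit the string with code n.-1./2. *)
Definition parent_rec T (z : T) (g : nat -> T -> T) (n : nat) : T :=
  parent_rec_fuel z g n n.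

Lemma parent_recS T (z : T) g n :
  parent_rec z g n.+1 = g n.+1 (parent_rec z g n./2).
Proof.
have stable m f : m <= f -> parent_rec_fuel z g f m = parent_rec z g m.
  elim/ltn_ind: m f => -[|m] IH [|f]//= mf; rewrite /parent_rec/=.
  by rewrite !IH//; lia.
by rewrite /parent_rec/= stable//; lia.
Qed.

Lemma rec1_parent : rec1 (fun n => n.-1./2).
Proof.
move=> K g rg; apply: recursive_ext (rterm_div (rec1P rg) (rterm_const K 1)).
by move=> x v; rewrite divn2.
Qed.

(** Reduces recursion along ancestors to primitive recursion: [anc n i] is the i-th ancestor of n,
    and [up n i] climbs from the root to [anc n (n - i)]. The n-th ancestor is always the root,
    where [up] stays at [z] until the path leaves it. *)
Lemma rec1_parent_rec z (g : nat -> nat -> nat) :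
  rec2 g -> rec1 (parent_rec z g).
Proof.
move=> rg.
pose anc n i := nat_rec (fun=> nat) n (fun _ a => a.-1./2) i.
have ranc : rec2 anc.
  move=> K h l rh rl.
  by apply: (rterm_iter (s := fun _ _ a _ => _) rl rh (rec1_parent (rterm_var _ 1))).
pose up n i := nat_rec (fun=> nat) z
  (fun m a => if 0 < anc n (n - m.+1) then g (anc n (n - m.+1)) a else z) i.
have rup : rec1 (fun n => up n n).
  apply: rec1_rterm.
  have ra : rterm 3 (fun _ e => anc (e 2) (e 2 - (e 0).+1)).
    apply: ranc (rterm_var _ 2) (rec2B (rterm_var _ 2) _).
    exact: rec1S (rterm_var _ 0).
  apply: (@rterm_iter 1 (fun _ e => e 0) (fun _ _ => z)
    (fun _ m a e => if 0 < anc (e 0) (e 0 - m.+1)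
                    then g (anc (e 0) (e 0 - m.+1)) a else z)).
  - exact: rterm_var.
  - exact: rterm_const.
  - apply: rterm_if (rterm_leq (rterm_const _ 1) ra) _ (rterm_const _ z).
    exact: rg ra (rterm_var _ 1).
have anc_le n i : anc n i <= n - i by elim: i => [|i] /=; lia.
have upE n i : i <= n -> up n i = parent_rec z g (anc n (n - i)).
  elim: i => [_|i IH ni].
    by rewrite subn0; have := anc_le n n; rewrite subnn leqn0 => /eqP ->.
  rewrite /= IH; last by lia.
  have -> : anc n (n - i) = (anc n (n - i.+1)).-1./2.
    by have -> : n - i = (n - i.+1).+1 by lia.
  by case: (anc n (n - i.+1)) => // m; rewrite parent_recS.
move=> K h rh; apply: recursive_ext (rup _ _ rh) => x v.
by rewrite upE// subnn.
Qed.

Lemma string_code_rcons s b :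
  string_code (rcons s b) = ((string_code s).*2 + b).+1.
Proof. by rewrite /string_code foldl_rcons. Qed.

Lemma parent_rec_child T (z : T) g n (b : bool) :
  parent_rec z g (n.*2 + b).+1 = g (n.*2 + b).+1 (parent_rec z g n).
Proof. by rewrite parent_recS; congr (g _ (parent_rec z g _)); lia. Qed.

Lemma parent_rec_rcons T (z : T) g s b :
  parent_rec z g (string_code (rcons s b)) =
  g (string_code (rcons s b)) (parent_rec z g (string_code s)).
Proof. by rewrite string_code_rcons parent_rec_child. Qed.

Lemma string_code_surj n : exists s, string_code s = n.
Proof.
elim/ltn_ind: n => -[|n] IH; first by exists [::].
have [|s sn] := IH n./2; first by lia.
by exists (rcons s (odd n)); rewrite string_code_rcons sn; lia.
Qed.

Definition depth := parent_rec 0 (fun _ a => a.+1).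

Lemma rec1_depth : rec1 depth.
Proof.
by apply: rec1_parent_rec => K g h _ rh; exact: rec1S.
Qed.

Lemma depth_string_code s : depth (string_code s) = size s.
Proof.
elim/last_ind: s => // s b IH.
by rewrite /depth parent_rec_rcons -/depth IH size_rcons.
Qed.

Lemma rterm_prefix_code K k : rterm K k ->
  rterm K (fun x e => string_code (mkseq x (k x e))).
Proof.
move=> rk.
have rs : rterm K.+2 (fun x e => ((e 1 * 2) + x (e 0)).+1).
  apply: rec1S; apply: rec2D (rterm_oracle (rterm_var _ 0)).
  exact: rec2M (rterm_var _ 1) (rterm_const _ 2).
have := rterm_iter (s := fun x m a _ => (a * 2 + x m).+1) rk (rterm_const K 0) rs.
apply: recursive_ext => x v; elim: (k x _) => [|m /= ->]//.
by rewrite mkseqS string_code_rcons muln2.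
Qed.

(** The use principle: a computation reads finitely many bits of its oracle. For minimization it
    suffices to preserve the values of [F] up to the minimum found for x; minimality for both
    oracles then forces the two minima to agree. *)
Lemma recursive_use k (F : cantor -> k.-tuple nat -> nat) : recursive F ->
  forall x v, exists n, forall y : cantor,
    (forall i, i < n -> y i = x i) -> F y v = F x v.
Proof.
elim=> {k F}.
- by move=> k x v; exists 0.
- by move=> x v; exists 0.
- by move=> k i x v; exists 0.
- move=> x v; exists (thead v).+1 => y yx; rewrite yx//.
- move=> k m F G _ IHF _ IHG x v.
  have [n Hn] := IHF x [tuple G i x v | i < m].
  have [n' Hn'] := choice (fun i => IHG i x v).
  exists (maxn n (\max_(i < m) n' i)) => y yx.
  rewrite -(Hn y) => [|i ni]; last by apply: yx; lia.
  congr (F y _); apply: eq_from_tnth => i; rewrite !tnth_mktuple.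
  apply: Hn' => j jn; apply: yx; apply: leq_trans (leq_maxr _ _).
  by apply: leq_trans jn _; exact: leq_bigmax.
- move=> k F G H _ IHF _ IHG H0 HS x; case/tupleP => n v; elim: n => [|n [n1 Hn1]].
    by have [n Hn] := IHF x v; exists n => y yx; rewrite !H0 Hn.
  have [n2 Hn2] := IHG x [tuple of n :: H x [tuple of n :: v] :: v].
  exists (maxn n1 n2) => y yx; rewrite !HS Hn1 => [|i ni].
    by rewrite Hn2// => i ni; apply: yx; lia.
  by apply: yx; lia.
- move=> k F H _ IHF H0 Hmin x v.
  have [n' Hn'] := choice (fun i => IHF x [tuple of i :: v]).
  exists (\max_(i < (H x v).+1) n' i) => y yx.
  have FE m : m <= H x v -> F y [tuple of m :: v] = F x [tuple of m :: v].
    rewrite -ltnS => mH; apply: Hn' => j jn; apply: yx; apply: leq_trans jn _.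
    exact: (leq_bigmax (Ordinal mH)).
  have [yx_lt|xy_lt|//] := ltngtP (H y v) (H x v).
    by have := Hmin x _ _ yx_lt; rewrite -FE ?H0// ltnW.
  by have := Hmin y _ _ xy_lt; rewrite FE// H0.
Qed.

End string_recursion.

(** * Measures on Cantor space *)

Section cantor_measurability.

Lemma cylinder_mkseqP (x y : cantor) n :
  cylinder (mkseq x n) y <-> forall i, (i < n)%N -> y i = x i.
Proof.
rewrite /cylinder/= size_mkseq; split=> h i ni; first by rewrite h// nth_mkseq.
by rewrite nth_mkseq// h.
Qed.

Lemma cylinder_mkseq (x : cantor) n : cylinder (mkseq x n) x.
Proof. exact/cylinder_mkseqP. Qed.

Lemma mkseq_cylinder s (x : cantor) : cylinder s x -> mkseq x (size s) = s.
Proof.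
move=> sx; apply: (@eq_from_nth _ false); rewrite size_mkseq// => i si.
by rewrite nth_mkseq// sx.
Qed.

Lemma cylinder_rcons s b :
  cylinder (rcons s b) = cylinder s `&` [set x | x (size s) = b].
Proof.
apply/seteqP; split => [x sbx|x [sx xb] i].
  split=> [i si|/=]; last by rewrite sbx ?size_rcons// nth_rcons ltnn eqxx.
  by rewrite sbx ?size_rcons ?nth_rcons ?si// ltnW.
rewrite size_rcons ltnS leq_eqVlt nth_rcons => /predU1P[->|si].
  by rewrite ltnn eqxx.
by rewrite si sx.
Qed.

Lemma cylinder_nil : cylinder [::] = setT.
Proof. by apply/seteqP; split. Qed.

Lemma cylinder_split s :
  cylinder s = cylinder (rcons s false) `|` cylinder (rcons s true).
Proof.
rewrite !cylinder_rcons -setIUr setIidl// => x _ /=.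
by case: (x _); [right|left].
Qed.

Lemma cylinder_disj s :
  [disjoint cylinder (rcons s false) & cylinder (rcons s true)].
Proof.
apply/disj_setPS => x; rewrite !cylinder_rcons => -[[_ /= ->] [_ /=]]; done.
Qed.

Lemma open_bit i b : open ([set x | x i = b] : set cantor_space).
Proof.
apply: (@open_comp _ _ (fun x : cantor_space => x i) [set b]).
  by move=> x _; exact: (@proj_continuous nat (fun=> bool) i x).
exact: discrete_open.
Qed.

Lemma measurable_cylinder s : measurable (cylinder s).
Proof.
elim/last_ind: s => [|s b IH]; first by rewrite cylinder_nil.
rewrite cylinder_rcons; apply: measurableI => //.
by apply: sub_sigma_algebra; exact: open_bit.
Qed.

(** The filter generated by the cylinders around x converges to x, because in the product topology
    this may be checked one coordinate at a time. *)
Lemma open_cylinder (A : set cantor_space) (x : cantor_space) :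
  open A -> A x -> exists n, cylinder (mkseq x n) `<=` A.
Proof.
move=> oA Ax.
pose F : set_system cantor_space := [set B | exists n, cylinder (mkseq x n) `<=` B].
have FF : Filter F.
  split; first by exists 0%N.
  - move=> B C [n Bn] [m Cm]; exists (maxn n m) => y /cylinder_mkseqP yx.
    by split; [apply: Bn|apply: Cm]; apply/cylinder_mkseqP => i im; apply: yx; lia.
  - by move=> B C BC [n Bn]; exists n; exact: subset_trans Bn BC.
suff : F --> x by move/(_ A); apply; exact: open_nbhs_nbhs.
apply/cvg_sup => i.
have proj_surj : (fun x : cantor_space => x i) @` setT = setT.
  by rewrite -subTset => b Tb; exists (fun=> b).
apply/(cvg_image _ _ proj_surj) => B /nbhs_singleton Bxi.
exists [set y : cantor_space | B (y i)].
  by exists i.+1 => y /cylinder_mkseqP /= ->.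
by apply/seteqP; split => [_ [y /= By <-]//|b Bb]; exists (fun=> b).
Qed.

(** The index type of strings is countable, so measurability passes from cylinders to open sets. *)
Lemma bigcup_cylinder (A : set cantor) :
  (forall x, A x -> exists n, cylinder (mkseq x n) `<=` A) ->
  A = \bigcup_(s : seq bool)
        (if `[< cylinder s `<=` A >] then cylinder s else set0).
Proof.
move=> locA; apply/seteqP; split => [x Ax|x [s _]].
  have [n nA] := locA x Ax; exists (mkseq x n) => //.
  by rewrite asboolT//; exact: cylinder_mkseq.
by case: asboolP => // sA; exact: sA.
Qed.

Lemma measurable_local (A : set cantor) :
  (forall x, A x -> exists n, cylinder (mkseq x n) `<=` A) -> measurable A.
Proof.
move=> /bigcup_cylinder ->.
apply: countable_bigcupT_measurable => [|s]; first exact: countableP.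
by case: asboolP => // _; exact: measurable_cylinder.
Qed.

Lemma measurable_fun_cylinder d (T : measurableType d) (f : T -> cantor) :
  (forall s, measurable (f @^-1` cylinder s)) -> measurable_fun setT f.
Proof.
move=> mf; apply: (@measurability _ _ _ cantor _ _ (@open cantor_space)) => //.
move=> _ [A oA <-]; rewrite setTI.
have locA x : A x -> exists n, cylinder (mkseq x n) `<=` A.
  exact: open_cylinder.
rewrite (bigcup_cylinder locA).
rewrite preimage_bigcup.
apply: countable_bigcupT_measurable => [|s]; first exact: countableP.
by case: asboolP => // _; rewrite preimage_set0.
Qed.

End cantor_measurability.

(** * Construction of a measure from its values on cylinders *)

Section measure_of_splitting.
Context (R : realType).
Variable v : nat -> R.
Hypotheses (v_ge0 : forall n, 0 <= v n) (v0 : v 0%N = 1).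
Hypothesis v_split : forall n, v n.*2.+1 + v n.*2.+2 = v n.

(* The unit interval is divided into half-open intervals of lengths v, in the
   lexicographic order of strings; the measure is the image of Lebesgue measure
   under the map sending u to the nested intervals that contain it. *)
Let left_end := parent_rec 0 (fun n a => if odd n then a else a + v n.-1).

Let coded_prefix (u : R) := fix coded_prefix k := if k is k'.+1 then
  let n := coded_prefix k' in (n.*2 + (left_end n + v n.*2.+1 <= u)%R).+1
  else 0%N.

Let expansion (u : R) : cantor :=
  fun k => let n := coded_prefix u k in left_end n + v n.*2.+1 <= u.

Let coded_prefixE u k : coded_prefix u k = string_code (mkseq (expansion u) k).
Proof.
by elim: k => // k IH; rewrite mkseqS string_code_rcons -IH.
Qed.

Let expansion_cylinder s u : 0 <= u < 1 ->
  cylinder s (expansion u) <->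
  left_end (string_code s) <= u < left_end (string_code s) + v (string_code s).
Proof.
move=> u01; elim/last_ind: s => [|s b IH].
  by rewrite cylinder_nil /left_end/= add0r v0.
have lE : left_end (string_code (rcons s b)) = left_end (string_code s) +
    (if b then v (string_code s).*2.+1 else 0).
  rewrite /left_end parent_rec_rcons string_code_rcons/= oddD odd_double/=.
  by case: b => //=; rewrite ?addr0// addn1.
rewrite lE string_code_rcons cylinder_rcons.
have sE : cylinder s (expansion u) -> expansion u (size s) =
    (left_end (string_code s) + v (string_code s).*2.+1 <= u).
  by move=> /mkseq_cylinder su; rewrite /expansion coded_prefixE su.
have := v_split (string_code s).
have := v_ge0 (string_code s).*2.+1; have := v_ge0 (string_code s).*2.+2.
move: sE IH; set l := left_end _; set a := v _.+1; set c := v _.+2.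
move=> sE IH c0 a0 lac.
case: b {lE}; rewrite ?addn1 ?addn0 -/a -/c ?addr0; split.
- by move=> [/[dup] /IH /andP[? ?] /sE /= -> ?]; apply/andP; split; lra.
- move=> /andP[? ?]; have sl : cylinder s (expansion u) by apply/IH; lra.
  by split=> //=; rewrite sE.
- move=> [/[dup] /IH /andP[? ?] /sE /= ->] /negbT; rewrite -ltNge => ?.
  by apply/andP; split.
- move=> /andP[? ?]; have sl : cylinder s (expansion u) by apply/IH; lra.
  by split=> //=; rewrite sE//; apply/negbTE; rewrite -ltNge.
Qed.

Let left_end_bounds s : 0 <= left_end (string_code s) /\
  left_end (string_code s) + v (string_code s) <= 1.
Proof.
elim/last_ind: s => [|s b [l0 l1]].
  by rewrite /left_end/= add0r v0.
have := v_split (string_code s).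
have := v_ge0 (string_code s).*2.+1; have := v_ge0 (string_code s).*2.+2.
rewrite /left_end parent_rec_rcons -/left_end string_code_rcons/= oddD odd_double/=.
by case: b => /=; rewrite ?addn1 ?addn0/=; move=> ? ? ?; split; lra.
Qed.

(** Outside the unit interval the value is arbitrary, since Lebesgue measure is restricted to that
    interval; a constant keeps the map measurable. *)
Let unit_expansion (u : measurableTypeR R) : cantor :=
  if 0 <= u < 1 then expansion u else fun=> false.

Let preimage_expansion s :
  unit_expansion @^-1` cylinder s `&` `[0, 1[ =
  `[left_end (string_code s), left_end (string_code s) + v (string_code s)[%classic.
Proof.
apply/seteqP; rewrite /unit_expansion; split => u /=; rewrite !in_itv/=.
  by move=> [/[swap] u01]; rewrite u01 => /(expansion_cylinder s u01).
move=> lur; have [l0 l1] := left_end_bounds s.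
have u01 : 0 <= u < 1 by move/andP: lur => [? ?]; apply/andP; split; lra.
by rewrite u01; split => //; apply/(expansion_cylinder s u01).
Qed.

Let measurable_unit_expansion : measurable_fun setT unit_expansion.
Proof.
apply: measurable_fun_cylinder => s.
rewrite -[X in measurable X]setIT -(setUv `[0%R, 1%R[%classic) setIUr.
apply: measurableU; first by rewrite preimage_expansion; exact: measurable_itv.
have mI : measurable (~` `[0, 1[%classic : set (measurableTypeR R)).
  by apply: measurableC; exact: measurable_itv.
have [sf|sf] := pselect (cylinder s (fun=> false)).
  rewrite (_ : _ `&` _ = ~` `[0, 1[%classic)//; apply: setIidr => u /=.
  by rewrite in_itv/= /unit_expansion => /negP/negbTE ->.
rewrite (_ : _ `&` _ = set0)//; apply/seteqP; split => // u [/=].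
by rewrite /unit_expansion in_itv/= => + /negP/negbTE u01; rewrite u01.
Qed.

Lemma cylinder_probability : exists P : probability cantor R,
  forall s, P (cylinder s) = (v (string_code s))%:E.
Proof.
have mI : measurable (`[0%R, 1%R[%classic : set (measurableTypeR R)).
  exact: measurable_itv.
pose lebesgue01 : {measure set (measurableTypeR R) -> \bar R} :=
  mrestr lebesgue_measure mI.
unshelve epose (M := pushforward lebesgue01 unit_expansion :
  {measure set cantor -> \bar R}); first exact: measurable_unit_expansion.
have ME s : M (cylinder s) = (v (string_code s))%:E.
  rewrite /M/= /pushforward /lebesgue01/= /mrestr preimage_expansion.
  rewrite lebesgue_measure_itv/= lte_fin ltrDl -EFinD.
  rewrite addrAC subrr add0r; case: ifPn => //; rewrite -leNgt => v_le0.
  by congr (_%:E); apply/eqP; rewrite eq_le v_ge0 v_le0.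
have M1 : M setT = 1%E by rewrite -cylinder_nil ME v0.
pose P : probability cantor R :=
  HB.pack (Measure.sort M) M (Measure_isProbability.Build _ _ _ M M1).
by exists P.
Qed.

End measure_of_splitting.

(** * The betting strategy *)

(** The preimage of any set is determined by the first n bits, so it is a union of cylinders,
    whatever [g] is. *)
Lemma measurable_prefix_fun d (T : measurableType d) (g : nat -> T) n :
  measurable_fun setT (fun x : cantor => g (string_code (mkseq x n))).
Proof.
move=> _ B _; rewrite setTI; apply: measurable_local => x /= Bx.
exists n => y /cylinder_mkseqP yx /=; suff -> : mkseq y n = mkseq x n by [].
apply: (@eq_from_nth _ false); rewrite !size_mkseq// => i ni.
by rewrite !nth_mkseq// yx.
Qed.

Section betting.
Local Open Scope nat_scope.
Variables U V : nat -> nat.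
Hypotheses (rec1U : rec1 U) (rec1V : rec1 V).
Hypothesis U_split : forall n, U n.*2.+1 + U n.*2.+2 <= 4 * U n.
Hypothesis V_split : forall n, V n.*2.+1 + V n.*2.+2 <= 4 * V n.
Hypothesis V0_gt0 : 0 < V 0.

(** At most one move is made per bit, even if the ratio V / U jumps further. So the level never
    exceeds the depth, and the exponent [depth n - level n] in [capital] is a true difference. *)
Definition level := parent_rec 0 (fun n l => l + (2 ^ l.+1 * U n <= V n)).

(* U and V approximate 4^|s| mu and 4^|s| nu from above. At level l, each unit
   of mu carries l protected units and a fraction 2^-l of nu is still at stake;
   multiplying by 8^|s| makes l * mu + 2^-l * nu an integer. *)
Definition capital n :=
  level n * 2 ^ depth n * U n + 2 ^ (depth n - level n) * V n.

(* The slack in the inequality capital_split is given to the first child. *)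
Definition wealth := parent_rec (V 0)
  (fun n a => if odd n then 8 * a - capital n.+1 else capital n).

Lemma depth_child n (b : bool) : depth (n.*2 + b).+1 = (depth n).+1.
Proof. exact: parent_rec_child. Qed.

Lemma level_child n (b : bool) : level (n.*2 + b).+1 =
  level n + (2 ^ (level n).+1 * U (n.*2 + b).+1 <= V (n.*2 + b).+1).
Proof. exact: parent_rec_child. Qed.

Lemma level_le_depth n : level n <= depth n.
Proof.
have [s <-] := string_code_surj n; elim/last_ind: s => // s b.
by rewrite string_code_rcons level_child depth_child; case: leqP; lia.
Qed.

(** A move costs nothing: protecting one more unit of [U] adds 2^(d+1) U, and halving the stake
    frees 2^(d-l) V, which is at least as much because 2^(l+1) U <= V. Without a move there is
    equality. *)
Lemma capital_child n (b : bool) : capital (n.*2 + b).+1 <=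
  2 * (level n * 2 ^ depth n * U (n.*2 + b).+1 +
       2 ^ (depth n - level n) * V (n.*2 + b).+1).
Proof.
rewrite /capital level_child depth_child.
have ld := level_le_depth n; move: (level n) (depth n) ld => l d ld.
move: (U _) (V _) => u w; have [uw|_] := leqP (2 ^ l.+1 * u) w; rewrite ?addn1 ?addn0.
  have := leq_mul (leqnn (2 ^ (d - l))) uw.
  rewrite subSS mulnA -expnD addnS subnK// !expnS; nia.
by rewrite subSn// !expnS; nia.
Qed.

Lemma capital_split n : capital n.*2.+1 + capital n.*2.+2 <= 8 * capital n.
Proof.
have := capital_child n false; have := capital_child n true.
rewrite addn1 addn0 => h1 h0; apply: leq_trans (leq_add h0 h1) _.
rewrite /capital; have := U_split n; have := V_split n.
move: (U n.*2.+1) (U n.*2.+2) (V n.*2.+1) (V n.*2.+2) => u0 u1 v0 v1.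
move: (level n * 2 ^ depth n) (2 ^ (depth n - level n)) => p q; nia.
Qed.

Lemma wealth_ge n : capital n <= wealth n.
Proof.
have [s <-] := string_code_surj n; elim/last_ind: s => [|s b IH].
  by rewrite /capital /= mul0n add0n mul1n.
rewrite string_code_rcons /wealth parent_rec_child -/wealth.
have := capital_split (string_code s); case: b => /=.
  by rewrite addn1/= odd_double.
by rewrite addn0/= odd_double/=; lia.
Qed.

Lemma wealth_split n : wealth n.*2.+1 + wealth n.*2.+2 = 8 * wealth n.
Proof.
have := parent_rec_child (V 0)
  (fun n a => if odd n then 8 * a - capital n.+1 else capital n) n false.
have := parent_rec_child (V 0)
  (fun n a => if odd n then 8 * a - capital n.+1 else capital n) n true.
rewrite addn0 addn1 -/wealth/= odd_double/= => -> ->.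
by have := capital_split n; have := wealth_ge n; lia.
Qed.

Lemma rec1_level : rec1 level.
Proof.
apply: rec1_parent_rec => K g h rg rh; apply: rec2D => //.
apply: rterm_leq; last exact: rec1V.
by apply: rec2M (rec1U rg); apply: rec2X (rec1S rh); exact: rterm_const.
Qed.

Lemma rec1_wealth : rec1 wealth.
Proof.
have rH : rec1 capital.
  move=> K g rg; apply: rec2D.
    apply: rec2M (rec1U rg); apply: rec2M (rec1_level rg) _.
    by apply: rec2X (rec1_depth rg); exact: rterm_const.
  apply: rec2M (rec1V rg); apply: rec2X; first exact: rterm_const.
  exact: rec2B (rec1_depth rg) (rec1_level rg).
apply: rec1_parent_rec => K g h rg rh; apply: rterm_if; first exact: rec1_odd.
  by apply: rec2B (rH _ _ (rec1S rg)); apply: rec2M rh; exact: rterm_const.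
exact: rH.
Qed.

Lemma level_prefix_homo (x : cantor) :
  {homo (fun k => level (string_code (mkseq x k))) : i j / i <= j}.
Proof.
apply: homo_leq => // [i j k|k]; first exact: leq_trans.
by rewrite mkseqS string_code_rcons level_child leq_addr.
Qed.

Local Open Scope ring_scope.
Context (R : realType).

Let v n : R := (wealth n)%:R / (V 0 * 8 ^ depth n)%:R.

Let den_gt0 n : (0 < V 0 * 8 ^ depth n)%N.
Proof. by rewrite muln_gt0 V0_gt0 expn_gt0. Qed.

Let v_split n : v n.*2.+1 + v n.*2.+2 = v n.
Proof.
have d0 : depth n.*2.+1 = (depth n).+1.
  by rewrite -[RHS](depth_child n false) addn0.
have d1 : depth n.*2.+2 = (depth n).+1.
  by rewrite -[RHS](depth_child n true) addn1.
rewrite /v d0 d1 -mulrDl -natrD wealth_split.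
by rewrite expnS mulnCA !natrM invfM mulrACA divff ?mul1r// natrM.
Qed.

Let wealth_probability : exists P : probability cantor R,
  forall s, P (cylinder s) = (v (string_code s))%:E.
Proof.
apply: cylinder_probability v_split => [n|]; first by rewrite divr_ge0// ler0n.
by rewrite /v /= muln1 divff// pnatr_eq0 -lt0n.
Qed.

(** The increments of the level telescope, so [gain x] is the limit of level / [V 0] along x. They
    are nonnegative and exactly computable, which makes [gain] a test. *)
Let bet i (x : cantor) : R :=
  (level (string_code (mkseq x i.+1)) - level (string_code (mkseq x i)))%:R /
  (V 0)%:R.

Let gain (x : cantor) : \bar R := (\sum_(0 <= i <oo) (bet i x)%:E)%E.

Let bet_ge0 i x : 0 <= bet i x.
Proof. by rewrite divr_ge0// ler0n. Qed.

Let sum_bet n x :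
  \sum_(0 <= i < n) bet i x = (level (string_code (mkseq x n)))%:R / (V 0)%:R.
Proof.
elim: n => [|n IH]; first by rewrite big_geq// mul0r.
rewrite big_nat_recr//= IH -mulrDl -natrD subnKC//.
exact: level_prefix_homo.
Qed.

Let lower_semicomputable_gain : lower_semicomputable gain.
Proof.
exists bet; split=> //.
exists (fun x v => level (string_code (mkseq x (nth 0 v 1).+1)) -
                   level (string_code (mkseq x (nth 0 v 1))))%N,
       (fun _ _ => 0%N), (fun _ _ => (V 0%N).-1); split.
- have rl k : rterm 2 k -> rterm 2 (fun x e => level (string_code (mkseq x (k x e)))).
    by move=> rk; apply: rec1_level; exact: rterm_prefix_code.
  exact: (rec2B (rl _ (rec1S (rterm_var 2 1))) (rl _ (rterm_var 2 1))).
- exact: (@rterm_const 2).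
- exact: (@rterm_const 2).
- by move=> x i n /=; rewrite subr0 prednK// subrr normr0 invr_ge0 exprn_ge0.
Qed.

(** The test is [gain], bounded by the measure of the normalized wealth: level times mu is covered
    by the protected part of the capital. *)
Lemma level_bounded (mu : {finite_measure set cantor -> \bar R}) (x : cantor) :
  (forall s, (mu (cylinder s) <= ((U (string_code s))%:R / 4 ^+ size s)%:E)%E) ->
  computably_random mu x ->
  exists B : nat, forall n, (level (string_code (mkseq x n)) <= B)%N.
Proof.
move=> muU x_random; have [P PE] := wealth_probability.
have gain_x : (gain x < +oo)%E.
  apply: (x_random gain P) => //.
    exists (fun _ v => wealth (nth 0 v 1)), (fun _ _ => 0%N),
       (fun _ v => (V 0 * 8 ^ depth (nth 0 v 1)).-1)%N; split.
    - exact: (rec1_wealth (rterm_var 2 1)).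
    - exact: (@rterm_const 2).
    - apply: (@rec1P 2 (fun _ e => V 0 * 8 ^ depth (e 1))%N); apply: rec2M (rterm_const _ _) _.
      by apply: rec2X (rterm_const _ _) _; exact: rec1_depth (rterm_var _ 1).
    - move=> _ s n /=.
      by rewrite subr0 prednK// PE/= subrr normr0 invr_ge0 exprn_ge0.
  move=> s; rewrite PE.
  pose g n (y : cantor) : \bar R :=
    ((level (string_code (mkseq y n)))%:R / (V 0)%:R)%:E.
  have g_ge0 n y : (0 <= g n y)%E by rewrite lee_fin divr_ge0// ler0n.
  have mg n D : measurable D -> measurable_fun D (g n).
    move=> mD; apply: (@measurable_funS _ _ _ _ setT) => //.
    exact: (measurable_prefix_fun (fun c => ((level c)%:R / (V 0)%:R)%:E : \bar R)).
  have mbet i D : measurable D -> measurable_fun D (fun y => (bet i y)%:E : \bar R).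
    move=> mD; apply: (@measurable_funS _ _ _ _ setT) => //.
    have := measurable_prefix_fun
      (fun c => ((level c - level c.-1./2)%:R / (V 0)%:R)%:E : \bar R) i.+1.
    apply: eq_measurable_fun => y _; rewrite /bet; congr ((_ - level _)%:R / _)%:E.
    by rewrite mkseqS string_code_rcons; lia.
  (* Induction on the number m of bits beyond t. For m = 0 the level is constant on the cylinder;
     the inductive step splits the cylinder and uses additivity of [v]. *)
  have integral_g m t : (\int[mu]_(y in cylinder t) g (size t + m)%N y <=
      (v (string_code t))%:E)%E.
    elim: m t => [|m IH] t.
      under eq_integral => y /set_mem/mkseq_cylinder ty.
        rewrite /g addn0 ty.
        over.
      rewrite integral_cst//; last exact: measurable_cylinder.
      apply: le_trans (lee_wpmul2l _ (muU t)) _.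
        by rewrite lee_fin divr_ge0// ler0n.
      rewrite -EFinM lee_fin /v depth_string_code.
      have H : (level (string_code t) * U (string_code t) * 2 ^ size t <=
                wealth (string_code t))%N.
        apply: leq_trans (wealth_ge _).
        by rewrite /capital depth_string_code mulnAC leq_addr.
      have -> : (V 0 * 8 ^ size t)%:R = 2 ^+ size t * ((V 0)%:R * 4 ^+ size t) :> R.
        by rewrite natrM natrX (natrM _ 2 4) exprMn mulrCA.
      rewrite mulrACA -invfM [(2 ^+ _ * _)^-1]invfM mulrA ler_pM2r; last first.
        by rewrite invr_gt0 mulr_gt0 ?ltr0n ?exprn_gt0.
      by rewrite ler_pdivlMr ?exprn_gt0// -natrX -!natrM ler_nat.
    rewrite cylinder_split ge0_integral_setU//.
    - rewrite addnS -addSn -{1}(size_rcons t false) -(size_rcons t true).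
      apply: le_trans (leeD (IH _) (IH _)) _.
      rewrite -EFinD lee_fin !string_code_rcons addn0 addn1.
      by rewrite le_eqVlt v_split eqxx.
    - exact: measurable_cylinder.
    - exact: measurable_cylinder.
    - by apply: mg; apply: measurableU; exact: measurable_cylinder.
    - exact: cylinder_disj.
  rewrite integral_nneseries//; last 3 first.
  - exact: measurable_cylinder.
  - by move=> i; apply: mbet; exact: measurable_cylinder.
  - by move=> i y _; rewrite lee_fin.
  apply: lime_le.
    by apply: is_cvg_nneseries => i _ _; apply: integral_ge0 => y _; rewrite lee_fin.
  apply: nearW => n.
  rewrite -ge0_integral_sum//; last 3 first.
  - exact: measurable_cylinder.
  - by move=> i; apply: mbet; exact: measurable_cylinder.
  - by move=> i y _; rewrite lee_fin.
  (* The first n bets add up to the level at length n, which is at most the level at length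
     [size s + n], the form that [integral_g] bounds. *)
  apply: le_trans (integral_g n s); apply: ge0_le_integral => //.
  - exact: measurable_cylinder.
  - by move=> y _; apply: sume_ge0 => i _; rewrite lee_fin.
  - by apply: emeasurable_sum => i; apply: mbet; exact: measurable_cylinder.
  - by apply: mg; exact: measurable_cylinder.
  - move=> y _; rewrite sumEFin sum_bet lee_fin ler_pM2r ?invr_gt0 ?ltr0n//.
    by rewrite ler_nat level_prefix_homo// leq_addl.
have gain_ge0 : (0 <= gain x)%E.
  by apply: nneseries_ge0 => i _ _; rewrite lee_fin.
have gain_fin : gain x \is a fin_num by rewrite ge0_fin_numE.
exists (Num.truncn ((V 0%N)%:R * fine (gain x))) => n.
rewrite truncn_ge_nat; last by rewrite mulr_ge0// fine_ge0.
rewrite mulrC -ler_pdivrMr ?ltr0n// -sum_bet -lee_fin fineK// -sumEFin.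
by apply: nneseries_lim_ge => i _ _; rewrite lee_fin.
Qed.

(** Once the largest level l on x has been reached, no move happens again, so V < 2^(l+1) U from the
    next prefix on. *)
Lemma betting_bounded (mu : {finite_measure set cantor -> \bar R}) (x : cantor) :
  (forall s, (mu (cylinder s) <= ((U (string_code s))%:R / 4 ^+ size s)%:E)%E) ->
  computably_random mu x ->
  exists J k0, forall k, (k0 <= k)%N ->
  (V (string_code (mkseq x k)) <= 2 ^ J * U (string_code (mkseq x k)))%N.
Proof.
move=> muU x_random; have [B levelB] := level_bounded muU x_random.
pose reached l := `[< exists k, level (string_code (mkseq x k)) = l >].
have exP : exists l, reached l by exists (level 0); apply/asboolP; exists 0%N.
have ubP l : reached l -> (l <= B)%N by move=> /asboolP[k <-].
case: (ex_maxnP exP ubP) => l lP lmax.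
have {lP} /asboolP[k0 k0l] := lP; exists l.+1, k0.+1 => -[//|k k0k].
have levelE i : (k0 <= i)%N -> level (string_code (mkseq x i)) = l.
  move=> k0i; apply/eqP; rewrite eqn_leq -{2}k0l level_prefix_homo// andbT.
  by apply: lmax; apply/asboolP; exists i.
have := levelE k.+1 (leqW k0k); rewrite mkseqS string_code_rcons level_child levelE//.
have [_|lt_V _] := leqP (2 ^ l.+1 * _) (V _); last exact: ltnW.
by rewrite addn1 => /eqP; rewrite eqn_leq ltnn.
Qed.

End betting.

(** * Approximations *)

Lemma divn_approx (R : realFieldType) (m d : nat) : (0 < d)%N ->
  (m %/ d)%:R <= (m%:R / d%:R : R) < (m %/ d)%:R + 1.
Proof.
move=> d0; rewrite ler_pdivlMr ?ltr0n// ltr_pdivrMr ?ltr0n//.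
by rewrite natr1 -!natrM ler_nat ltr_nat leq_divM ltn_ceil.
Qed.

(** The integer is the floor of 2^q times the rational approximation. Rounding and approximation
    each contribute an error of at most 1. *)
Lemma computable_real_approx (R : realType) (I : Type) (k : nat)
    (code : I -> k.-tuple nat) (f : I -> R) :
  computable_real code (fun=> f) -> (forall i, 0 <= f i) ->
  exists r : (nat -> nat) -> nat, rterm k.+1 (fun=> r) /\
    forall q i, `|(r (nth 0%N (q :: code i)))%:R - 2 ^+ q * f i| <= 2.
Proof.
move=> [a [b [c [ra rb rc fE]]]] f_ge0.
pose A (F : cantor -> k.+1.-tuple nat -> nat) (e : nat -> nat) :=
  F (fun=> false) [tuple e i | i < k.+1].
have rA F : recursive F -> rterm k.+1 (fun=> A F).
  move=> /recursive_fix_oracle; apply: recursive_ext => _ v.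
  by congr (F _ _); apply: eq_from_tnth => i; rewrite tnth_mktuple (tnth_nth 0%N).
have AE F q i : A F (nth 0%N (q :: code i)) =
    F (fun=> false) [tuple of q :: code i].
  by congr (F _ _); apply: eq_from_tnth => j; rewrite tnth_mktuple (tnth_nth 0%N).
exists (fun e => 2 ^ e 0 * (A a e - A b e) %/ (A c e).+1)%N; split.
  apply: rterm_div; last exact: rA.
  apply: rec2M; last exact: (rec2B (rA _ ra) (rA _ rb)).
  exact: (rec2X (rterm_const _ 2) (rterm_var _ 0)).
move=> q i; rewrite !AE/=; have /= := fE (fun=> false) i q.
have := f_ge0 i; move: (f i) => y y0.
move: (a _ _) (b _ _) (c _ _) => a' b' c' /= {}fE.
have /andP[] := divn_approx R (2 ^ q * (a' - b')) (ltn0Sn c').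
rewrite natrM natrX -mulrA; set d := (_ %/ _)%:R; set z := _ / _ => d1 d2.
have q0 : (0 : R) < 2 ^+ q by rewrite exprn_gt0.
suff : `|2 ^+ q * z - 2 ^+ q * y| <= 1 by rewrite !ler_distl; lra.
rewrite -mulrBr normrM gtr0_norm// -ler_pdivlMl// mulr1.
apply: le_trans fE; rewrite /z; have [ab|/ltnW ba] := leqP b' a'.
  by rewrite natrB// distrC.
(* The rational (a - b) / c is at most 0 here, so truncating it to 0 only brings it closer to y >=
   0. *)
move: (ba); rewrite -subn_eq0 => /eqP ->.
rewrite mul0r sub0r normrN ger0_norm// ler_normr; apply/orP; left.
rewrite lerDl oppr_ge0 pmulr_lle0 ?invr_gt0 ?ltr0n// subr_le0 ler_nat//.
Qed.

Section approximation.
Context (R : realType) (g : seq bool -> R) (u : nat -> nat).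
Hypothesis u_near : forall s,
  `|(u (string_code s))%:R - 4 ^+ size s * g s| <= 2.
Hypothesis g_split : forall s,
  g (rcons s false) + g (rcons s true) <= g s + 2 / 4 ^+ size s.

(* The constant c = 10 is the least with 2 * c + 20 <= 4 * c, where 20 bounds
   the errors committed in s and its two children. *)
Lemma near_split n :
  ((u n.*2.+1 + 10) + (u n.*2.+2 + 10) <= 4 * (u n + 10))%N.
Proof.
have [s <-] := string_code_surj n.
have q0 : (0 : R) < 4 ^+ size s by rewrite exprn_gt0.
have gs : 4 ^+ size s * g (rcons s false) + 4 ^+ size s * g (rcons s true) <=
          4 ^+ size s * g s + 2.
  rewrite -mulrDr; apply: le_trans (ler_wpM2l (ltW q0) (g_split s)) _.
  by rewrite mulrDr mulrCA divff ?mulr1 ?gt_eqF.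
have := u_near (rcons s false); have := u_near (rcons s true).
have := u_near s.
rewrite !string_code_rcons !size_rcons addn0 addn1 -(ler_nat R) !exprS.
rewrite natrM !natrD !ler_distl -!mulrA; move: gs.
by move: (4 ^+ _ * _) (4 ^+ _ * _) (4 ^+ _ * _) => ? ? ?; lra.
Qed.

End approximation.

(** Transfers [betting_bounded] from integer approximations to the real functions. The slack 2 /
    4^|s| allows g and h to be sums whose range and weights grow with the length of s. *)
Lemma random_dominated (R : realType) (mu : probability cantor R) x
    (g h : seq bool -> R) (u w : nat -> nat) :
  computably_random mu x -> rec1 u -> rec1 w ->
  (forall s, `|(u (string_code s))%:R - 4 ^+ size s * g s| <= 2) ->
  (forall s, `|(w (string_code s))%:R - 4 ^+ size s * h s| <= 2) ->
  (forall s, g (rcons s false) + g (rcons s true) <= g s + 2 / 4 ^+ size s) ->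
  (forall s, h (rcons s false) + h (rcons s true) <= h s + 2 / 4 ^+ size s) ->
  (forall s, (mu (cylinder s) <= (g s + 4 ^- size s)%:E)%E) ->
  exists J k0, forall k, (k0 <= k)%N -> h (mkseq x k) < 2 ^+ J * g (mkseq x k).
Proof.
move=> x_random ru rw u_near w_near g_split h_split mu_le.
(* The 10 comes from [near_split]. The term 2^depth adds the uniform measure to h; on prefixes of
   length at least J + 4 it exceeds all rounding errors, of order 2^J, and so gives a strict
   inequality. *)
pose U n := (u n + 10)%N; pose V n := (w n + 10 + 2 ^ depth n)%N.
have rU : rec1 U by move=> K f rf; apply: rec2D (ru _ _ rf) (rterm_const _ _).
have rV : rec1 V.
  move=> K f rf; apply: rec2D (rec2D (rw _ _ rf) (rterm_const _ _)) _.
  exact: rec2X (rterm_const _ _) (rec1_depth rf).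
have V_split n : (V n.*2.+1 + V n.*2.+2 <= 4 * V n)%N.
  have := near_split w_near h_split n; rewrite /V.
  have := depth_child n false; have := depth_child n true.
  by rewrite addn0 addn1 => -> ->; rewrite expnS; lia.
have mu_U s : (mu (cylinder s) <= ((U (string_code s))%:R / 4 ^+ size s)%:E)%E.
  apply: le_trans (mu_le s) _; rewrite lee_fin.
  have q0 : (0 : R) < 4 ^+ size s by rewrite exprn_gt0.
  rewrite ler_pdivlMr// mulrDl mulVf ?gt_eqF// mulrC natrD.
  by have := u_near s; rewrite ler_distl; lra.
have V0 : (0 < V 0)%N by rewrite /V; lia.
have [J [k0 VU]] := betting_bounded rU rV (near_split u_near g_split)
  V_split V0 mu_U x_random.
exists J, (k0 + J + 4)%N => k kk.
have k0k : (k0 <= k)%N by lia.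
have := VU k k0k; rewrite /U /V.
have := u_near (mkseq x k); have := w_near (mkseq x k).
rewrite depth_string_code size_mkseq -(ler_nat R).
have q0 : (0 : R) < 4 ^+ k by rewrite exprn_gt0.
rewrite -[_ < _ * _](ltr_pM2l q0) [4 ^+ k * (_ * _)]mulrCA.
rewrite natrM !natrD !natrX !ler_distl.
have : 16%:R * 2 ^+ J <= 2 ^+ k :> R.
  rewrite -natrX -natrM -natrX ler_nat (_ : 16 = 2 ^ 4)%N// -expnD.
  by rewrite leq_exp2l//; lia.
have j0 : (0 : R) < 2 ^+ J by rewrite exprn_gt0.
move: (4 ^+ k * g _) (4 ^+ k * h _) (w _)%:R (u _)%:R => gk hk wk uk.
move: (2 ^+ J) (2 ^+ k) j0 => J' k' j0 Jk /andP[hk_wk _] /andP[_ uk_gk] wk_uk.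
by have := ler_wpM2l (ltW j0) uk_gk; rewrite mulrDr; lra.
Qed.

(** * Countable sums of measures and their tails *)

Section countable_sum.
Context (R : realType) (mu : probability cantor R)
  (mu_ : nat -> {finite_measure set cantor -> \bar R}).
Hypothesis mu_computable : computable_measures (fun n => mu_ n).
Hypothesis mu_sum : forall A : set cantor, measurable A ->
  mu A = (\sum_(0 <= n <oo) mu_ n A)%E.

Definition mass n s : R := fine (mu_ n (cylinder s)).

Lemma mass_ge0 n s : 0 <= mass n s.
Proof. exact: fine_ge0. Qed.

Lemma mu_cylinder n s : mu_ n (cylinder s) = (mass n s)%:E.
Proof. by rewrite fineK// fin_num_measure//; exact: measurable_cylinder. Qed.

Lemma mass_split n s : mass n (rcons s false) + mass n (rcons s true) = mass n s.
Proof.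
apply: EFin_inj; rewrite EFinD -!mu_cylinder (cylinder_split s) measureU//;
  try exact: measurable_cylinder.
exact/eqP/cylinder_disj.
Qed.

Lemma mass_le n s : mass n s <= mass n [::].
Proof.
elim/last_ind: s => // s b IH; apply: le_trans IH; rewrite -(mass_split n s).
by case: b; rewrite ?lerDl ?lerDr mass_ge0.
Qed.

Lemma mass_approx : exists r : nat -> nat -> nat -> nat, rec3 r /\
  forall q n s, `|(r q n (string_code s))%:R - 2 ^+ q * mass n s| <= 2.
Proof.
have [|r [rr rE]] := computable_real_approx mu_computable.
  by move=> [n s]; exact: mass_ge0.
exists (fun q n c => r (nth 0 [:: q; n; c]))%N; split; last first.
  by move=> q n s; exact: (rE q (n, s)).
apply: rec3_rterm.
apply: recursive_ext (rterm_subst (g := fun i _ e => e i) rr (rterm_var 3)).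
move=> _ v /=; congr r; apply/funext => i.
by case: i => [//|[//|[//|i]]]; rewrite /= nth_nil.
Qed.

Lemma sum_mass_le s N : ((\sum_(n < N) mass n s)%:E <= mu (cylinder s))%E.
Proof.
rewrite mu_sum; last exact: measurable_cylinder.
rewrite -sumEFin -(big_mkord predT (fun n => (mass n s)%:E)).
under eq_bigr do rewrite -mu_cylinder.
exact: nneseries_lim_ge.
Qed.

Lemma mu_cylinder_le s B : (forall N, \sum_(n < N) mass n s <= B) ->
  (mu (cylinder s) <= B%:E)%E.
Proof.
move=> sumB; rewrite mu_sum; last exact: measurable_cylinder.
apply: lime_le; first exact: is_cvg_nneseries.
apply: nearW => N; under eq_bigr do rewrite mu_cylinder.
by rewrite big_mkord sumEFin lee_fin.
Qed.

Lemma mass_total_le1 N : \sum_(n < N) mass n [::] <= 1.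
Proof.
by rewrite -lee_fin; apply: le_trans (sum_mass_le _ _) _; rewrite cylinder_nil probability_setT.
Qed.

Lemma mass_total_cvg e : 0 < e -> exists N, 1 - e <= \sum_(n < N) mass n [::].
Proof.
move=> e0; apply: contrapT => /forallNP small.
have /mu_cylinder_le : forall N, \sum_(n < N) mass n [::] <= 1 - e.
  by move=> N; have /negP := small N; rewrite -ltNge => /ltW.
by rewrite cylinder_nil probability_setT lee_fin; lra.
Qed.

(** The total mass is known to be 1, so the first N whose partial sum is visibly close to 1 can be
    found by search. *)
Lemma mass_modulus : exists M, rec1 M /\
  forall i, 1 - 2 ^- i <= \sum_(n < M i) mass n [::].
Proof.
have [r [rr rE]] := mass_approx.
have {}rE q n : `|(r q n 0%N)%:R - 2 ^+ q * mass n [::]| <= 2.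
  exact: (rE q n [::]).
(* At this scale N errors of 2 total at most 2^(N+1), that is 2^-(i+2). The test [enough] allows
   twice that: it succeeds once the tail is at most 2^-(i+2), and its success bounds the tail by
   2^-i. *)
pose q N i := (N + i + 3)%N.
pose enough N i := (2 ^ q N i <= \sum_(n < N) r (q N i) n 0 + 2 ^ (N + 2))%N.
have sum_near N i : `|(\sum_(n < N) r (q N i) n 0)%:R -
    2 ^+ q N i * \sum_(n < N) mass n [::]| <= 2 ^+ N.+1.
  rewrite natr_sum mulr_sumr -sumrB; apply: le_trans (ler_norm_sum _ _ _) _.
  apply: (le_trans (ler_sum _ (fun (n : 'I_N) _ => rE (q N i) n))).
  rewrite sumr_const card_ord exprS -[leLHS]mulr_natr ler_pM2l// -natrX ler_nat.
  exact: ltnW (ltn_expl _ _).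
have ex_enough i : exists N, enough N i.
  have [N NE] := @mass_total_cvg (2 ^- (i + 2)) ltac:(by rewrite invr_gt0 exprn_gt0).
  exists N; rewrite /enough -(ler_nat R) natrD !natrX.
  have := sum_near N i; rewrite ler_distl => /andP[+ _].
  have q0 : (0 : R) < 2 ^+ q N i by rewrite exprn_gt0.
  have := ler_wpM2l (ltW q0) NE; rewrite mulrBr.
  have -> : 2 ^+ q N i / 2 ^+ (i + 2) = 2 ^+ N.+1 :> R.
    by rewrite -expfB_cond ?pnatr_eq0//; [congr (_ ^+ _); rewrite /q; lia|rewrite /q; lia].
  by rewrite mulr1 addnS addn1 !exprS; lra.
exists (fun i => ex_minn (ex_enough i)); split.
  apply: (@rec1_ex_minn enough); first last.
  - by move=> i m; case: ex_minnP => N _ /(_ m) Nm; apply: contraL => /Nm; rewrite -leqNgt.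
  - by move=> i; case: ex_minnP.
  have rq : rterm 2 (fun _ e => q (e 0) (e 1))%N.
    by apply: rec2D (rec2D _ _) (rterm_const _ _); exact: rterm_var.
  apply: rterm_leq; first exact: rec2X (rterm_const _ _) rq.
  apply: rec2D; last exact: rec2X (rterm_const _ _) (rec2D (rterm_var _ 0) (rterm_const _ _)).
  apply: (rterm_sum (F := fun _ n e => r (q (e 0) (e 1)) n 0)%N (rterm_var _ 0)).
  apply: rr (rterm_var _ 0) (rterm_const _ _).
  by apply: rec2D (rec2D _ _) (rterm_const _ _); exact: rterm_var.
move=> i; case: ex_minnP => N + _; rewrite /enough -(ler_nat R) natrD !natrX.
have := sum_near N i; rewrite ler_distl => /andP[_].
have q0 : (0 : R) < 2 ^+ q N i by rewrite exprn_gt0.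
rewrite -[1 - _ <= _](ler_pM2l q0) mulrBr mulr1.
have -> : 2 ^+ q N i / 2 ^+ i = 2 ^+ N.+3 :> R.
  by rewrite -expfB_cond ?pnatr_eq0//; [congr (_ ^+ _); rewrite /q; lia|rewrite /q; lia].
have N0 : (0 : R) < 2 ^+ N by rewrite exprn_gt0.
rewrite addnS addn1 !exprS; lra.
Qed.

(** * Weighted sums with a cutoff depending on the length *)

Section weights.
Variable M : nat -> nat.
Hypotheses (rec1M : rec1 M)
  (M_modulus : forall i, 1 - 2 ^- i <= \sum_(n < M i) mass n [::]).

Lemma sum_le_head_tail (F : nat -> R) (m N : nat) : (forall n, 0 <= F n) ->
  \sum_(n < N) F n <= \sum_(n < m) F n + \sum_(m <= n < maxn m N) F n.
Proof.
move=> F0; rewrite -!(big_mkord predT) -big_cat_nat//=; last exact: leq_maxl.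
rewrite [leRHS](big_cat_nat (leq0n N) (leq_maxr m N))/=.
by rewrite lerDl sumr_ge0.
Qed.

Lemma tail_mass i b s : \sum_(M i <= n < b) mass n s <= 2 ^- i.
Proof.
apply: (@le_trans _ _ (\sum_(M i <= n < b) mass n [::])).
  by apply: ler_sum => n _; exact: mass_le.
have [bM|/ltnW Mb] := leqP b (M i); first by rewrite big_geq// invr_ge0 exprn_ge0.
have := mass_total_le1 b; rewrite -(big_mkord predT (mass^~ [::])) (big_cat_nat (leq0n _) Mb)/=.
have := M_modulus i; rewrite -(big_mkord predT (mass^~ [::])); lra.
Qed.

Variable w : nat -> nat -> nat.
Hypotheses (rec2w : rec2 w) (w_le : forall n k, (w n k <= 2 ^ k)%N).
Hypothesis w_step : forall n k, (w n k.+1 <= w n k + (M (3 * k) <= n) * 2 ^ k)%N.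

(** The cutoff keeps the sum finite, hence computable. Its index 3 * |s| makes the omitted mass at
    most 8^-|s|, which weights up to 2^|s| can raise only to 4^-|s|. *)
Definition weighted_mass s : R :=
  \sum_(n < M (3 * size s)) (w n (size s))%:R * mass n s.

(** Below the old cutoff the weights do not grow, and the masses are additive. The indices from the
    old cutoff on contribute at most 2^(k+1) * 8^-k = 2 / 4^k. *)
Lemma weighted_mass_split s :
  weighted_mass (rcons s false) + weighted_mass (rcons s true) <=
  weighted_mass s + 2 / 4 ^+ size s.
Proof.
rewrite /weighted_mass !size_rcons -big_split/=.
under eq_bigr do rewrite -mulrDr mass_split.
set k := size s; set N := M (3 * k).
have F0 n : 0 <= (w n k.+1)%:R * mass n s by rewrite mulr_ge0// mass_ge0.
apply: le_trans (sum_le_head_tail N _ F0) _; apply: lerD.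
  apply: ler_sum => n _; rewrite ler_wpM2r ?mass_ge0// ler_nat.
  by have := w_step n k; rewrite -/N [(N <= n)%N]leqNgt (ltn_ord n) mul0n addn0.
have -> : 2 / 4 ^+ k = 2 ^+ k.+1 * 2 ^- (3 * k) :> R.
  have -> : (3 * k = k + 2 * k)%N by lia.
  rewrite exprD exprM invfM mulrA exprS mulfK; last first.
    by rewrite expf_eq0 pnatr_eq0 andbF.
  by rewrite -[2 ^+ 2]natrX.
apply: le_trans (ler_wpM2l _ (tail_mass _ _ s)); last by rewrite exprn_ge0.
rewrite mulr_sumr; apply: ler_sum => n _; rewrite ler_wpM2r ?mass_ge0//.
by rewrite -natrX ler_nat.
Qed.

(** Each of the N terms has error at most 2^(k+1), so the sum has error at most 2^(k+N+1). Dividing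
    by that number leaves an error of 1, rounding adds another, and the precision [q] is chosen so
    that the scale 4^k remains. *)
Lemma weighted_mass_near : exists u, rec1 u /\
  forall s, `|(u (string_code s))%:R - 4 ^+ size s * weighted_mass s| <= 2.
Proof.
have [r [rr rE]] := mass_approx.
pose N c := M (3 * depth c).
pose q c := (3 * depth c + N c + 1)%N.
exists (fun c => (\sum_(n < N c) w n (depth c) * r (q c) n c) %/
                 (2 ^ (depth c + N c + 1)).-1.+1)%N; split.
  have rN : rec1 N.
    move=> K f rf; apply: rec1M; apply: rec2M (rec1_depth rf).
    exact: rterm_const.
  have rq : rec1 q.
    move=> K f rf; apply: rec2D (rec2D _ (rN _ _ rf)) (rterm_const _ _).
    by apply: rec2M (rec1_depth rf); exact: rterm_const.
  apply: rec1_rterm; apply: rterm_div.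
    apply: (rterm_sum (F := fun _ n e => w n (depth (e 0)) * r (q (e 0)) n (e 0))%N).
      exact: rN (rterm_var _ _).
    apply: rec2M; first exact: rec2w (rterm_var _ _) (rec1_depth (rterm_var _ 2)).
    exact: rr (rq _ _ (rterm_var _ 2)) (rterm_var _ 0) (rterm_var _ 2).
  apply: rec1P; apply: rec2X (rterm_const _ _) _.
  apply: rec2D (rec2D _ (rN _ _ _)) (rterm_const _ _); last exact: rterm_var.
  exact: rec1_depth (rterm_var _ _).
move=> s; rewrite prednK ?expn_gt0//.
set c := string_code s; set k := depth c.
have kE : size s = k by rewrite /k depth_string_code.
have := divn_approx R (\sum_(n < N c) w n k * r (q c) n c)
  (_ : 0 < 2 ^ (k + N c + 1))%N.
rewrite expn_gt0 => /(_ isT) /andP[].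
set d := (_ %/ _)%:R; set S := (\sum_(n < N c) _)%:R; rewrite natrX => d1 d2.
have S_near : `|S - 2 ^+ q c * weighted_mass s| <= 2 ^+ (k + N c + 1).
  rewrite /S /weighted_mass kE natr_sum mulr_sumr -sumrB.
  apply: le_trans (ler_norm_sum _ _ _) _.
  apply: (@le_trans _ _ (\sum_(n < N c) 2 ^+ k * 2)).
    apply: ler_sum => n _; rewrite natrM mulrCA -mulrBr normrM ger0_norm//.
    by apply: ler_pM => //; [rewrite -natrX ler_nat | exact: rE].
  rewrite sumr_const card_ord -[leLHS]mulr_natr -natrX -!natrM -natrX ler_nat.
  by rewrite !expnD expn1 mulnAC leq_mul// leq_mul// ltnW// ltn_expl.
have e0 : (0 : R) < 2 ^+ (k + N c + 1) by rewrite exprn_gt0.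
have qE : 2 ^+ q c = 2 ^+ (k + N c + 1) * 4 ^+ k :> R.
  have -> : q c = (k + N c + 1 + 2 * k)%N by rewrite /q; lia.
  by rewrite exprD exprM -[2 ^+ 2]natrX.
suff : `|S / 2 ^+ (k + N c + 1) - 4 ^+ size s * weighted_mass s| <= 1.
  by rewrite !ler_distl; lra.
rewrite -(ler_pM2l e0) mulr1 -{1}(gtr0_norm e0) -normrM mulrBr mulrCA.
by rewrite mulfV ?gt_eqF// mulr1 mulrA kE -qE.
Qed.

End weights.

End countable_sum.

(** * Lower semicontinuity of tests, and the conclusion *)

Section lower_semicontinuity.
Context (R : realType).

Definition locally_approx (F : cantor -> R) := forall x e, 0 < e ->
  exists n, forall y, cylinder (mkseq x n) y -> `|F y - F x| <= e.

(** Computable functions are continuous: by [recursive_use], all y sharing a long prefix with x have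
    the same approximation of precision e / 2. *)
Lemma computable_locally_approx (f : nat -> cantor -> R) :
  computable_real (fun i : nat => [tuple i]) (fun x i => f i x) ->
  forall i, locally_approx (f i).
Proof.
move=> [a [b [c [ra rb rc fE]]]] i x e e0.
have [q qe] : exists q, 2 ^- q <= e / 2 :> R.
  exists (Num.truncn (2 / e)).+1.
  rewrite -[leRHS]invrK lef_pV2 ?posrE ?exprn_gt0 ?invr_gt0 ?divr_gt0// invf_div.
  apply: ltW; apply: lt_le_trans (truncnS_gt _) _.
  by rewrite -natrX ler_nat ltnW// ltn_expl.
pose v := [tuple of q :: [tuple i]].
have [na xa] := recursive_use ra x v; have [nb xb] := recursive_use rb x v.
have [nc xc] := recursive_use rc x v.
exists (maxn na (maxn nb nc)) => y /cylinder_mkseqP yx.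
have /= := fE y i q; rewrite -/v xa ?xb ?xc; try by move=> j jn; apply: yx; lia.
have /= := fE x i q; rewrite -/v !ler_distl.
by move: ((_ - _) / _) (2 ^- q) qe => z p pe; lra.
Qed.

Lemma measurable_locally_approx (F : cantor -> R) :
  locally_approx F -> measurable_fun setT F.
Proof.
move=> locF; apply: (measurability _ (RGenOInfty.measurableE R)) => //.
move=> _ [_ [a ->] <-]; rewrite setTI; apply: measurable_local => x /=.
rewrite in_itv/= andbT => aF.
have e0 : 0 < (F x - a) / 2 by lra.
have [n xn] := locF x _ e0; exists n => y /xn/=.
by rewrite in_itv/= andbT ler_distl; lra.
Qed.

Lemma locally_approx_sum (f : nat -> cantor -> R) N :
  (forall i, locally_approx (f i)) ->
  locally_approx (fun x => \sum_(0 <= i < N) f i x).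
Proof.
move=> locf; elim: N => [|N IH] x e e0.
  by exists 0%N => y _; rewrite !big_geq// subrr normr0 ltW.
have e20 : 0 < e / 2 by lra.
have [n1 xn1] := IH x _ e20; have [n2 xn2] := locf N x _ e20.
exists (maxn n1 n2) => y /cylinder_mkseqP yx; rewrite !big_nat_recr//=.
have : cylinder (mkseq x n1) y by apply/cylinder_mkseqP => i ni; apply: yx; lia.
have : cylinder (mkseq x n2) y by apply/cylinder_mkseqP => i ni; apply: yx; lia.
by move=> /xn2 + /xn1; rewrite !ler_distl; lra.
Qed.

(** Some partial sum of the test exceeds C + 1 at x and, being continuous, varies by at most 1 on a
    cylinder around x. So t >= C there, and this is integrated. *)
Lemma test_bound (m : {finite_measure set cantor -> \bar R})
    (nu : probability cantor R) (t : cantor -> \bar R) (x : cantor) :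
  lower_semicomputable t ->
  (forall s, (\int[m]_(y in cylinder s) t y <= nu (cylinder s))%E) ->
  t x = +oo%E -> forall C, 0 <= C ->
  exists k0, forall k, (k0 <= k)%N ->
    (C%:E * m (cylinder (mkseq x k)) <= nu (cylinder (mkseq x k)))%E.
Proof.
move=> [f [f_ge0 /computable_locally_approx locf tE]] t_le tx C C0.
have [N NC] : exists N, C + 1 < \sum_(0 <= i < N) f i x.
  apply: contrapT => /forallNP small.
  suff : (t x <= (C + 1)%:E)%E by rewrite tx leye_eq.
  rewrite tE; apply: lime_le.
    by apply: is_cvg_nneseries => i _ _; rewrite lee_fin.
  by apply: nearW => N; rewrite sumEFin lee_fin leNgt; apply/negP; exact: small.
have [n xn] := locally_approx_sum N locf x ltr01.
exists n => k nk; apply: le_trans (t_le _).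
rewrite -integral_cst; last exact: measurable_cylinder.
have mt : measurable_fun setT t.
  rewrite (_ : t = fun y => (\sum_(0 <= i <oo) (f i y)%:E)%E); last exact/funext.
  apply: ge0_emeasurable_sum => [i y _ _|i _]; first by rewrite lee_fin.
  by apply/measurable_EFinP; exact: measurable_locally_approx.
apply: ge0_le_integral => //.
- exact: measurable_cylinder.
- exact: measurable_funS mt.
- move=> y /cylinder_mkseqP yx; rewrite tE.
  have /xn : cylinder (mkseq x n) y by apply/cylinder_mkseqP => i ni; apply: yx; lia.
  rewrite ler_distl => xy.
  apply: (@le_trans _ _ (\sum_(0 <= i < N) (f i y)%:E)%E).
    by rewrite sumEFin lee_fin; lra.
  by apply: nneseries_lim_ge => i _ _; rewrite lee_fin.
Qed.

End lower_semicontinuity.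

(** * Bounds along the prefixes of a random sequence *)

Section domination.
Context (R : realType) (mu : probability cantor R)
  (mu_ : nat -> {finite_measure set cantor -> \bar R}).
Hypothesis mu_computable : computable_measures (fun n => mu_ n).
Hypothesis mu_sum : forall A : set cantor, measurable A ->
  mu A = (\sum_(0 <= n <oo) mu_ n A)%E.
Local Notation mass := (mass mu_).

Lemma random_ratio (x : cantor) : computably_random mu x ->
  exists (N : nat) (g : nat -> R),
    (forall nu : probability cantor R, computable_measure nu ->
      exists J k0, forall k, (k0 <= k)%N ->
        fine (nu (cylinder (mkseq x k))) < 2 ^+ J * g k) /\
    exists k0, forall k, (k0 <= k)%N ->
      g k <= 2 * \sum_(n < N) mass n (mkseq x k).
Proof.
move=> x_random; have [M [rM M_mod]] := mass_modulus mu_computable mu_sum.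
pose g := weighted_mass mu_ M (fun _ _ => 1%N).
have one_le (n k : nat) : (1 <= 2 ^ k)%N by rewrite expn_gt0.
have one_step (n k : nat) : (1 <= 1 + (M (3 * k) <= n) * 2 ^ k)%N by [].
have rec_one : rec2 (fun _ _ => 1%N) by move=> *; exact: rterm_const.
have [u [ru u_near]] := weighted_mass_near mu_computable rM rec_one one_le.
have g_split := weighted_mass_split mu_sum M_mod one_le one_step.
have mu_g s : (mu (cylinder s) <= (g s + 4 ^- size s)%:E)%E.
  apply: (mu_cylinder_le mu_sum) => N.
  apply: le_trans (sum_le_head_tail (M (3 * size s)) N (fun n => mass_ge0 mu_ n s)) _.
  apply: lerD; first by rewrite /g /weighted_mass; under [leRHS]eq_bigr do rewrite mul1r.
  apply: le_trans (tail_mass mu_sum M_mod _ _ _) _.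
  rewrite lef_pV2 ?posrE ?exprn_gt0// -!natrX ler_nat.
  by rewrite (_ : 4 = 2 ^ 2)%N// -expnM leq_exp2l//; lia.
(* A finite form of the weight of mu_n in the sum over i of 2^i times the tail from M (3 i): only i
   < k count at length k. *)
pose v n k := (\sum_(i < k) (M (3 * i) <= n) * 2 ^ i)%N.
have v_le n k : (v n k <= 2 ^ k)%N.
  suff : (v n k < 2 ^ k)%N by exact: ltnW.
  rewrite /v; elim: k => [|k IH]; first by rewrite big_ord0.
  rewrite big_ord_recr/= expnS mul2n -addnn -addSn leq_add//.
  by case: (M _ <= n)%N; rewrite ?mul1n.
have v_step n k : (v n k.+1 <= v n k + (M (3 * k) <= n) * 2 ^ k)%N.
  by rewrite /v big_ord_recr.
have rec_v : rec2 v.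
  apply: rec2_rterm.
  apply: (rterm_sum (F := fun _ i e => (M (3 * i) <= e 0) * 2 ^ i)%N (rterm_var _ 1)).
  apply: rec2M; last exact: rec2X (rterm_const _ _) (rterm_var _ 0).
  apply: rterm_leq (rterm_var _ 2); apply: rM.
  exact: rec2M (rterm_const _ _) (rterm_var _ 0).
have [w [rw w_near]] := weighted_mass_near mu_computable rM rec_v v_le.
have h_split := weighted_mass_split mu_sum M_mod v_le v_step.
have [J [k0 hg]] := random_dominated x_random ru rw u_near w_near g_split h_split mu_g.
(* For n >= M (3 (J + 1)) the weight is at least 2^(J+1) as soon as k > J + 1. Then 2^(J+1) * tail
   <= h < 2^J * g, so the tail is below g / 2 and the head is above g / 2. *)
exists (M (3 * J.+1)), (fun k => g (mkseq x k)); split; last first.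
  exists (maxn k0 J.+2) => k kk; have := hg k ltac:(lia).
  set s := mkseq x k; have sk : size s = k by rewrite size_mkseq.
  set N := M (3 * J.+1) => hJ.
  have := sum_le_head_tail N (M (3 * k)) (fun n => mass_ge0 mu_ n s).
  have gE : g s = \sum_(n < M (3 * k)) mass n s.
    by rewrite /g /weighted_mass sk; under eq_bigr do rewrite mul1r.
  rewrite -gE.
  have : 2 ^+ J.+1 * \sum_(N <= n < maxn N (M (3 * k))) mass n s <=
         weighted_mass mu_ M v s.
    rewrite /weighted_mass sk.
    have [MN|/ltnW NM] := leqP (M (3 * k)) N.
      rewrite big_geq// mulr0; apply: sumr_ge0 => n _.
      by rewrite mulr_ge0// mass_ge0.
    rewrite -(big_mkord predT (fun n => (v n k)%:R * mass n s)).
    rewrite [leRHS](big_cat_nat (leq0n N) NM)/= mulr_sumr.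
    apply: ler_wpDl; first by apply: sumr_ge0 => n _; rewrite mulr_ge0// mass_ge0.
    apply: ler_sum_nat => n /andP[Nn _]; rewrite ler_wpM2r ?mass_ge0//.
    have Jk : (J.+1 < k)%N by lia.
    rewrite -natrX ler_nat /v (bigD1 (Ordinal Jk))//= -/N Nn mul1n.
    exact: leq_addr.
  have j0 : (0 : R) < 2 ^+ J by rewrite exprn_gt0.
  move: (\sum_(N <= n < _) _) (\sum_(n < N) _) hJ => tl hd hJ th gs.
  have : 2 ^+ J * (2 * tl) < 2 ^+ J * g s.
    by rewrite mulrA -exprSr; exact: le_lt_trans th hJ.
  by rewrite ltr_pM2l//; lra.
(* For nu the same domination applies with h = nu, approximated at precision 2 |s| because 2^(2 |s|)
   = 4^|s|. *)
move=> nu nu_computable.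
have [|r [rr rE]] := computable_real_approx nu_computable.
  by move=> s; exact: fine_ge0.
apply: (@random_dominated _ _ _ g (fun s => fine (nu (cylinder s))) u
  (fun c => r (nth 0 [:: 2 * depth c; c]))%N x_random ru _ u_near _ g_split _ mu_g).
- apply: rec1_rterm.
  have := rterm_subst (K := 1) (g := fun i _ e => if i is 0 then 2 * depth (e 0) else e 0)%N rr.
  have rg i : rterm 1 (fun _ e => if i is 0 then 2 * depth (e 0) else e 0)%N.
    case: i => [|i]; last exact: rterm_var.
    exact: rec2M (rterm_const _ _) (rec1_depth (rterm_var _ _)).
  move=> /(_ rg); apply: recursive_ext => _ e /=; congr r; apply/funext => i.
  by case: i => [//|[//|i]]; rewrite /= nth_nil.
- move=> s; have := rE (2 * depth (string_code s))%N s.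
  by rewrite depth_string_code exprM -[2 ^+ 2]natrX.
- move=> s; apply: (@le_trans _ _ (fine (nu (cylinder s)))); last first.
    by rewrite lerDl divr_ge0// exprn_ge0.
  rewrite -fineD ?fin_num_measure//; try exact: measurable_cylinder.
  rewrite (cylinder_split s) measureU//; try exact: measurable_cylinder.
  exact/eqP/cylinder_disj.
Qed.

End domination.

Theorem theorem5p1 (R : realType) (mu : probability cantor R)
    (mu_ : nat -> {finite_measure set cantor -> \bar R})
    (mu_computable : computable_measures (fun n => mu_ n))
    (mu_sum : forall A : set cantor, measurable A ->
       mu A = (\sum_(0 <= n <oo) mu_ n A)%E)
    (x : cantor) (x_random : computably_random mu x) :
  exists n : nat, computably_random (mu_ n) x.
Proof.
apply: contrapT => /forallNP not_random.
have [N [g [g_dom [k0 g_le]]]] := random_ratio mu_computable mu_sum x_random.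
have small n : exists K, forall k, (K <= k)%N ->
    N%:R * 4 * mass mu_ n (mkseq x k) < g k.
  have /existsNP[t /existsNP[nu /not_implyP[t_lsc /not_implyP[nu_computable
    /not_implyP[t_le /negP]]]]] := not_random n.
  rewrite -leNgt leye_eq => /eqP tx.
  have [J [k1 nu_g]] := g_dom nu nu_computable.
  (* This C yields 2^J * 4N * mu_n <= nu < 2^J * g, where 2^J cancels. *)
  have C0 : 0 <= 2 ^+ J * (N%:R * 4) :> R by rewrite !mulr_ge0.
  have [k2 C_nu] := test_bound t_lsc t_le tx C0.
  exists (maxn k1 k2) => k kk; have j0 : (0 : R) < 2 ^+ J by rewrite exprn_gt0.
  rewrite -(ltr_pM2l j0); apply: le_lt_trans (nu_g k ltac:(lia)).
  rewrite mulrA -lee_fin fineK ?fin_num_measure//; last exact: measurable_cylinder.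
  by rewrite EFinM -mu_cylinder; apply: C_nu; lia.
have [K KP] := choice small.
(* [K 0] is included even if N = 0: the strict inequality for n = 0 shows that g k is positive. *)
pose k := maxn k0 (maxn (K 0%N) (\max_(n < N) K n)).
have sum_le : N%:R * 4 * (\sum_(n < N) mass mu_ n (mkseq x k)) <= N%:R * g k.
  rewrite mulr_sumr; apply: (@le_trans _ _ (\sum_(n < N) g k)); last first.
    by rewrite sumr_const card_ord mulr_natl.
  apply: ler_sum => n _; apply/ltW/KP; rewrite /k.
  by apply: leq_trans (leq_maxr _ _); apply: leq_trans (leq_maxr _ _); exact: leq_bigmax.
have g_gt0 : 0 < g k.
  apply: le_lt_trans (KP 0%N k _); last by rewrite /k; lia.
  by rewrite !mulr_ge0// mass_ge0.
have gk := g_le k (leq_maxl _ _); have [N0|N_gt0] := posnP N.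
  move: gk; rewrite big1 ?mulr0 => [|[n nN] _]; first by rewrite leNgt g_gt0.
  by exfalso; rewrite N0 in nN.
(* With S the sum of the first N masses, 4 S <= g k <= 2 S contradicts g k > 0. *)
by move: sum_le; rewrite -mulrA ler_pM2l ?ltr0n//; lra.
Qed.
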